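(* Let $H=\langle\eta\rangle$ be a finite submonoid of $\mathbb K^*$, let $a_1,\dots,a_r$ be integers, and let $Y=Y_{A,H}=\{[t_1^{a_1}:\cdots:t_r^{a_r}] : t_i\in H\}\subseteq T_X$ be the corresponding degenerate torus. Let $d_i=|\eta^{a_i}|$ be the order of $\eta^{a_i}$ and $D=\operatorname{diag}(d_1,\dots,d_r)$. Then $I(Y)=I_L$ for the lattice $L=D(L_{\beta D})$, where $L_{\beta D}=\operatorname{Ker}(\beta D)\subseteq\mathbb Z^r$.
   Context: Setting. $X$ is a complete simplicial toric variety over a field $\mathbb K$ given by a fan $\Sigma\subset\mathbb R^n$ with rays $\rho_1,\dots,\rho_r$ and corresponding primitive lattice generators $\mathbf v_1,\dots,\mathbf v_r\in\mathbb Z^n$. The matrix $\phi:\mathbb Z^n\to\mathbb Z^r$ has rows $\mathbf v_1,\dots,\mathbf v_r$, and there is an exact sequence $0\to\mathbb Z^n\xrightarrow{\phi}\mathbb Z^r\xrightarrow{\beta}\mathcal A\to 0$ with $\mathcal A\cong \mathrm{Cl}(X)$. The Cox ring $S=\mathbb K[x_1,\dots,x_r]$ is graded by $\mathcal A$ via $\deg x_j=\beta_j:=\beta(e_j)$; ''homogeneous'' refers to this grading. Let $\mathbf u_1,\dots,\mathbf u_n\in\mathbb Z^r$ be the columns of $\phi$, write $\mathbf t^{\mathbf u}=t_1^{u_1}\cdots t_r^{u_r}$, let $\pi:(\mathbb K^* )^r\to T_X\cong(\mathbb K^* )^n$, $\pi(\mathbf t)=(\mathbf t^{\mathbf u_1},\dots,\mathbf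 t^{\mathbf u_n})$, and $G=\ker\pi$. The torus $T_X$ is split and $1\to G\to(\mathbb K^* )^r\xrightarrow{\pi}T_X\to1$ is assumed exact, so $T_X=(\mathbb K^* )^r/G$; the order of the torsion part of $\mathcal A$ is assumed coprime to the characteristic of $\mathbb K$. For $P=(p_1,\dots,p_r)\in(\mathbb K^* )^r$, $[P]=[p_1:\cdots:p_r]=G\cdot P$. For $Y\subseteq T_X$, $I(Y)\subseteq S$ is the ideal generated by the homogeneous polynomials vanishing on $Y$. For a subgroup $L\subseteq\mathbb Z^r$, writing $\mathbf m=\mathbf m^+-\mathbf m^-$ with $\mathbf m^{\pm}\in\mathbb N^r$ the positive and negative parts, the lattice ideal is $I_L=\langle \mathbf x^{\mathbf m^+}-\mathbf x^{\mathbf m^-} : \mathbf m\in L\rangle$. Here $\beta D:\mathbb Z^r\to\mathcal A$ is the composition of $D:\mathbb Z^r\to\mathbb Z^r$ with $\beta$, and $D(L_{\beta D})$ is the image of $L_{\beta D}$ under $D$. *)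

(* Defs.v *)
From mathcomp Require Import all_boot all_order all_algebra.
From mathcomp Require Import boolp classical_sets functions cardinality reals.
From mathcomp Require Import mpoly.

Set Implicit Arguments.
Unset Strict Implicit.
Unset Printing Implicit Defensive.

Import Order.TTheory GRing.Theory Num.Theory.

Local Open Scope classical_set_scope.
Local Open Scope ring_scope.

(* Vectors of N = Z^n and of N_R = R^n are rows, vectors of the dual
   lattice and of its real extension are columns, so that the pairing is the
   matrix product. *)

Definition realv (R : realType) (n : nat) (v : 'rV[int]_n) : 'rV[R]_n :=
  map_mx (intr : int -> R) v.
Arguments realv R {n} v.

Definition cone (R : realType) (n k : nat) (u : 'I_k -> 'rV[int]_n) :
    set 'rV[R]_n :=
  [set x | exists c : 'I_k -> R,
     (forall i, 0 <= c i) /\ x = \sum_i c i *: realv R (u i)].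
Arguments cone R {n k} u.

Definition rational_polyhedral (R : realType) (n : nat)
    (sigma : set 'rV[R]_n) : Prop :=
  exists (k : nat) (u : 'I_k -> 'rV[int]_n), sigma = cone R u.

Definition strongly_convex (R : realType) (n : nat)
    (sigma : set 'rV[R]_n) : Prop :=
  forall x, sigma x -> sigma (- x) -> x = 0.

Definition is_face (R : realType) (n : nat) (tau sigma : set 'rV[R]_n) : Prop :=
  exists m : 'cV[R]_n,
    (forall x, sigma x -> 0 <= (x *m m) 0 0) /\
    tau = sigma `&` [set x | (x *m m) 0 0 = 0].

Definition is_fan (R : realType) (n : nat)
    (Sigma : set (set 'rV[R]_n)) : Prop :=
  [/\ finite_set Sigma,
      forall sigma, Sigma sigma ->
        rational_polyhedral sigma /\ strongly_convex sigma,
      forall sigma tau, Sigma sigma -> is_face tau sigma -> Sigma tau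
    & forall sigma tau, Sigma sigma -> Sigma tau ->
        is_face (sigma `&` tau) sigma /\ is_face (sigma `&` tau) tau].

Definition complete_fan (R : realType) (n : nat)
    (Sigma : set (set 'rV[R]_n)) : Prop :=
  \bigcup_(sigma in Sigma) sigma = [set: 'rV[R]_n].

Definition simplicial_fan (R : realType) (n : nat)
    (Sigma : set (set 'rV[R]_n)) : Prop :=
  forall sigma, Sigma sigma ->
    exists (k : nat) (u : 'I_k -> 'rV[int]_n),
      sigma = cone R u /\ row_free (\matrix_(i < k) realv R (u i)).

Definition ray (R : realType) (n : nat) (w : 'rV[int]_n) : set 'rV[R]_n :=
  cone R (fun _ : 'I_1 => w).
Arguments ray R {n} w.

Definition primitive_vector (n : nat) (w : 'rV[int]_n) : Prop :=
  \big[gcdn/0%N]_(j < n) absz (w 0 j) = 1%N.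

(* v lists, without repetition, the primitive generators of the rays of Sigma *)
Definition primitive_ray_generators (R : realType) (n r : nat)
    (Sigma : set (set 'rV[R]_n)) (v : 'I_r -> 'rV[int]_n) : Prop :=
  [/\ injective v,
      forall i, primitive_vector (v i),
      forall i, Sigma (ray R (v i))
    & forall w, w != 0 -> Sigma (ray R w) -> exists i, ray R w = ray R (v i)].

Definition ray_matrix (n r : nat) (v : 'I_r -> 'rV[int]_n) : 'M[int]_(r, n) :=
  \matrix_(i < r) v i.

(* 0 -> Z^n -phi-> Z^r -beta-> A -> 0, with phi acting on columns *)
Definition short_exact (n r : nat) (phi : 'M[int]_(r, n)) (A : zmodType)
    (beta : {additive 'cV[int]_r -> A}) : Prop :=
  [/\ injective (fun u : 'cV[int]_n => phi *m u),
      forall m : 'cV[int]_r, beta m = 0 <-> exists u, m = phi *m u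
    & forall x : A, exists m, x = beta m].

Definition torsion_part (A : zmodType) : set A :=
  [set x | exists2 k : nat, (0 < k)%N & x *+ k = 0].
Arguments torsion_part A x : clear implicits.

Definition torus (K : fieldType) (r : nat) : set {ffun 'I_r -> K} :=
  [set t | forall i, t i != 0].
Arguments torus K r t : clear implicits.

Definition tpow (K : fieldType) (r : nat) (t : {ffun 'I_r -> K})
    (u : 'cV[int]_r) : K :=
  \prod_(i < r) t i ^ u i 0.

Definition torus_map (K : fieldType) (n r : nat) (phi : 'M[int]_(r, n))
    (t : {ffun 'I_r -> K}) : {ffun 'I_n -> K} :=
  [ffun j => tpow t (col j phi)].

Definition torus_ker (K : fieldType) (n r : nat) (phi : 'M[int]_(r, n)) :
    set {ffun 'I_r -> K} :=
  [set g | torus K r g /\ torus_map phi g = [ffun=> 1]].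
Arguments torus_ker K {n r} phi g.

(* The point [P] = [p_1 : ... : p_r] of T_X, i.e. the orbit G . P *)
Definition tpoint (K : fieldType) (n r : nat) (phi : 'M[int]_(r, n))
    (P : {ffun 'I_r -> K}) : set {ffun 'I_r -> K} :=
  [set [ffun i => g i * P i] | g in torus_ker K phi].

Definition degenerate_torus (K : fieldType) (n r : nat) (phi : 'M[int]_(r, n))
    (a : 'I_r -> int) (H : set K) : set (set {ffun 'I_r -> K}) :=
  [set tpoint phi [ffun i => t i ^ a i] |
     t in [set t : {ffun 'I_r -> K} | forall i, H (t i)]].

Definition ideal_gen (K : fieldType) (r : nat) (F : set {mpoly K[r]}) :
    set {mpoly K[r]} :=
  [set f | exists s : seq ({mpoly K[r]} * {mpoly K[r]}),
     (forall p, p \in s -> F p.2) /\ f = \sum_(p <- s) p.1 * p.2].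

Definition mdegA (r : nat) (A : zmodType) (beta : {additive 'cV[int]_r -> A})
    (m : 'X_{1..r}) : A :=
  \sum_(j < r) beta (delta_mx j 0) *+ m j.

Definition homogeneous (K : fieldType) (r : nat) (A : zmodType)
    (beta : {additive 'cV[int]_r -> A}) (f : {mpoly K[r]}) : Prop :=
  exists alpha : A, forall m, m \in msupp f -> mdegA beta m = alpha.

(* For homogeneous f this does not depend on the representative P. *)
Definition vanishes_on (K : fieldType) (n r : nat) (phi : 'M[int]_(r, n))
    (Y : set (set {ffun 'I_r -> K})) (f : {mpoly K[r]}) : Prop :=
  forall P, torus K r P -> Y (tpoint phi P) -> f.@[P] = 0.

Definition vanishing_ideal (K : fieldType) (n r : nat) (phi : 'M[int]_(r, n))
    (A : zmodType) (beta : {additive 'cV[int]_r -> A})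
    (Y : set (set {ffun 'I_r -> K})) : set {mpoly K[r]} :=
  ideal_gen [set f | homogeneous beta f /\ vanishes_on phi Y f].

Definition pos_part (r : nat) (m : 'cV[int]_r) : 'X_{1..r} :=
  [multinom absz (Num.max (m i 0) 0)%R | i < r].

Definition neg_part (r : nat) (m : 'cV[int]_r) : 'X_{1..r} :=
  pos_part (- m).

Definition lattice_ideal (K : fieldType) (r : nat) (L : set 'cV[int]_r) :
    set {mpoly K[r]} :=
  ideal_gen [set 'X_[pos_part m] - 'X_[neg_part m] | m in L].
Arguments lattice_ideal K {r} L f.

Definition diag_int (r : nat) (d : 'I_r -> nat) : 'M[int]_r :=
  diag_mx (\row_(i < r) (d i)%:Z).

(* D (Ker (beta D)) *)
Definition degenerate_lattice (r : nat) (A : zmodType)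
    (beta : {additive 'cV[int]_r -> A}) (D : 'M[int]_r) : set 'cV[int]_r :=
  [set D *m m | m in [set m : 'cV[int]_r | beta (D *m m) = 0]].

(* Main.v *)
Require Import Defs.
From mathcomp Require Import all_boot all_order all_algebra zify.
From mathcomp Require Import boolp classical_sets functions cardinality reals.
From mathcomp Require Import mpoly.

Set Implicit Arguments.
Unset Strict Implicit.
Unset Printing Implicit Defensive.

Import Order.TTheory GRing.Theory Num.Theory.

Local Open Scope classical_set_scope.
Local Open Scope ring_scope.

(** Write omega_i = eta^(a_i), a primitive d_i-th root of unity.  The points of
    Y are represented by the tuples (omega_1^(k_1), ..., omega_r^(k_r)), that
    is, by the points of the grid mu_(d_1) x ... x mu_(d_r).

    The inclusion I_L in I(Y) is a computation: for m in L the two monomials of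
    x^(m+) - x^(m-) have the same degree because beta m = 0, and they agree on
    Y because the character t^m is trivial there: on G since m lies in
    ker beta = im phi, and on the grid since d_i divides m_i
    ([tpow_degenerate], [lattice_sub_vanishing]).

    For the other inclusion let f be homogeneous and vanish on Y, hence on the
    grid.  On the grid a monomial x^m only depends on the residues of the m_i
    modulo d_i, and monomials with distinct residues are distinct, hence
    linearly independent, characters of the group mu_(d_1) x ... x mu_(d_r).
    So the coefficients of f in each residue class add up to zero
    ([residue_class_sum0]).  Subtracting from each monomial of f a fixed
    monomial of f in the same class therefore does not change f, and f becomes a
    combination of differences x^m - x^m' with m = m' modulo (d_1, ..., d_r)
    ([sum_fibre_differences]).  As f is homogeneous, beta (m - m') = 0 as well;
    so m - m' is in L ([same_residues_lattice]) and x^m - x^m' is a monomial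
    multiple of a generator of I_L ([lattice_ideal_binomial]). *)

(** * Ideals generated by a set of polynomials *)

Section IdealGen.
Variables (K : fieldType) (r : nat).
Implicit Types (F G : set {mpoly K[r]}) (f g : {mpoly K[r]}).

Lemma ideal_gen_mem F f : F f -> ideal_gen F f.
Proof.
move=> Ff; exists [:: (1, f)]; split; last by rewrite big_seq1 mul1r.
by move=> p; rewrite inE => /eqP->.
Qed.

Lemma ideal_gen0 F : ideal_gen F 0.
Proof. by exists [::]; split=> //; rewrite big_nil. Qed.

Lemma ideal_genD F f g : ideal_gen F f -> ideal_gen F g -> ideal_gen F (f + g).
Proof.
move=> [s [sF ->]] [t [tF ->]]; exists (s ++ t); split; last by rewrite big_cat.
by move=> p; rewrite mem_cat => /orP[/sF|/tF].
Qed.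

Lemma ideal_genM F g f : ideal_gen F f -> ideal_gen F (g * f).
Proof.
move=> [s [sF ->]]; exists [seq (g * p.1, p.2) | p <- s]; split.
  by move=> p /mapP[q /sF qF ->].
by rewrite mulr_sumr big_map; apply: eq_bigr => p _; rewrite mulrA.
Qed.

Lemma ideal_gen_sum F (I : eqType) (s : seq I) (h : I -> {mpoly K[r]}) :
  (forall i, i \in s -> ideal_gen F (h i)) -> ideal_gen F (\sum_(i <- s) h i).
Proof.
move=> Fh; rewrite big_seq.
by elim/big_ind: _ => //; [exact: ideal_gen0 | exact: ideal_genD].
Qed.

Lemma ideal_gen_sub F G : F `<=` ideal_gen G -> ideal_gen F `<=` ideal_gen G.
Proof.
move=> FG f [s [sF ->]]; apply: ideal_gen_sum => p /sF /FG.
exact: ideal_genM.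
Qed.

End IdealGen.

(** * Exponent vectors and lattice ideals *)

Section LatticeBinomials.
Variables (K : fieldType) (r : nat).

Definition exponent_col (m : 'X_{1..r}) : 'cV[int]_r := \col_i (m i)%:Z.

Lemma absz_max0 (k : int) : `|Num.max k 0|%N%:Z = Num.max k 0.
Proof. by case: (leP k 0) => [//|/ltW]; case: k. Qed.

Lemma exponent_col_parts (m : 'cV[int]_r) :
  exponent_col (pos_part m) - exponent_col (neg_part m) = m.
Proof. apply/colP => i; rewrite !mxE !mnmE !mxE !absz_max0.
by move: (m i 0) => k; case: leP; case: leP; lia.
Qed.

Lemma mdegA_exponent_col (A : zmodType) (beta : {additive 'cV[int]_r -> A}) m :
  mdegA beta m = beta (exponent_col m).
Proof.
rewrite /mdegA; under eq_bigr => j _ do rewrite -raddfMn.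
rewrite -raddf_sum; congr (beta _); apply/colP => i.
rewrite summxE mxE (bigD1 i) //= big1 ?addr0 => [|j ji].
  by rewrite mulmxnE mxE !eqxx; lia.
by rewrite mulmxnE mxE eq_sym (negPf ji) mul0rn.
Qed.

(** Lattice ideals are generated by binomials with coprime terms; dividing
    x^m - x^m' by the gcd of its two terms gives the generator that belongs to
    the vector m - m'. *)
Lemma lattice_ideal_binomial (L : set 'cV[int]_r) (m m' : 'X_{1..r}) :
  L (exponent_col m - exponent_col m') ->
  lattice_ideal K L ('X_[m] - 'X_[m']).
Proof.
set z := _ - _ => Lz.
have posE : pos_part z = (m - m')%MM.
  by apply/mnmP => i; rewrite mnmBE mnmE !mxE; move: (m i) (m' i); lia.
have negE : neg_part z = (m' - m)%MM.
  by apply/mnmP => i; rewrite mnmBE mnmE !mxE; move: (m i) (m' i); lia.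
(* subtraction of multinomials is truncated, so c is the minimum of m and m' *)
pose c := (m - (m - m'))%MM.
have -> : 'X_[m] - 'X_[m'] = 'X_[c] * ('X_[pos_part z] - 'X_[neg_part z])
    :> {mpoly K[r]}.
  rewrite mulrBr -!mpolyXD posE negE; congr ('X_[_] - 'X_[_]);
  by apply/mnmP => i; rewrite mnmDE !mnmBE; lia.
by apply: ideal_genM; apply: ideal_gen_mem; exists z.
Qed.

End LatticeBinomials.

(** * Linear combinations whose coefficients cancel on fibres *)

Section Fibres.
Variables (K : pzRingType) (V : lmodType K) (T U : eqType).
Variables (s : seq T) (c : T -> K) (q : T -> U).
Hypothesis fibre0 : forall t, t \in s -> \sum_(x <- s | q x == q t) c x = 0.

Lemma sum_fibres_eq0 (y : U -> V) : \sum_(x <- s) c x *: y (q x) = 0.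
Proof.
have fibres x : x \in s ->
    c x *: y (q x) = \sum_(u <- undup (map q s) | q x == u) c x *: y u.
  move=> xs; rewrite big_mkcond (bigD1_seq (q x)) ?undup_uniq //=; last first.
    by rewrite mem_undup map_f.
  by rewrite eqxx big1 ?addr0 // => u; rewrite eq_sym => /negPf->.
rewrite (eq_big_seq _ fibres) (exchange_big_dep predT) //= big_seq big1 // => u.
rewrite mem_undup => /mapP[t ts ->].
by rewrite -scaler_suml fibre0 ?scale0r.
Qed.

(** The subtracted term is the value of [y] at the first element of [s] in the
    fibre of [x]; it depends on the fibre alone, so the subtracted terms cancel.
    Since this element lies in [s], a property common to all the elements of
    [s], such as having a given degree, is available for it. *)
Lemma sum_fibre_differences (x0 : T) (y : T -> V) :
  \sum_(x <- s) c x *: y x =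
  \sum_(x <- s) c x *: (y x - y (nth x0 s (index (q x) (map q s)))).
Proof.
under [RHS]eq_bigr => x _ do rewrite scalerBr.
rewrite sumrB (sum_fibres_eq0 (fun u => y (nth x0 s (index u (map q s))))).
by rewrite subr0.
Qed.

Lemma fibre_repP (x0 x : T) (xs : x \in s) :
  let x' := nth x0 s (index (q x) (map q s)) in x' \in s /\ q x' = q x.
Proof.
have lt_s : (index (q x) (map q s) < size s)%N.
  by rewrite -(size_map q) index_mem map_f.
split; first exact: mem_nth.
by rewrite -(nth_map x0 (q x)) // nth_index // map_f.
Qed.

End Fibres.

(** * Polynomials vanishing on a product of groups of roots of unity *)

Section Grid.
Variables (K : fieldType) (r : nat).

Lemma sum_root_of_unity n (z : K) : z ^+ n = 1 ->
  \sum_(k < n) z ^+ k = if z == 1 then n%:R else 0.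
Proof.
move=> zn1; case: eqVneq => [->|z1].
  by under eq_bigr => k _ do rewrite expr1n; rewrite sumr_const card_ord.
apply/eqP; move/eqP: (subrX1 z n); rewrite zn1 subrr eq_sym mulf_eq0.
by rewrite subr_eq0 (negPf z1).
Qed.

Definition residues (d : 'I_r -> nat) (m : 'X_{1..r}) : {ffun 'I_r -> nat} :=
  [ffun i => m i %% d i]%N.

(** Orthogonality of characters: averaging the values of [f] on the grid
    against the inverse of the character of [c] extracts the sum of the
    coefficients of the monomials that restrict to this character.  The average
    makes sense because d is invertible in a field with a primitive
    d-th root of unity. *)
Lemma residue_class_sum0 (d : 'I_r -> nat) (w : 'I_r -> K) (f : {mpoly K[r]}) :
  (forall i, (d i).-primitive_root (w i)) ->
  (forall k : 'I_r -> nat, f.@[fun i => w i ^+ k i] = 0) ->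
  forall c : 'X_{1..r},
    \sum_(m <- msupp f | residues d m == residues d c) f@_m = 0.
Proof.
move=> w_prim f0 c.
(* Every exponent k i runs over the same range 'I_n, with n a common multiple of
   the d i; each point of the grid is just hit several times. *)
pose n := (\prod_i d i)%N.
have w_n i : w i ^+ n = 1.
  by apply/eqP; rewrite -(prim_order_dvd (w_prim i)) /n (bigD1 i) ?dvdn_mulr.
have n0 : n%:R != 0 :> K.
  rewrite natr_prod prodf_seq_neq0; apply/allP => i _.
  exact/implyP/(fun=> prim_root_natf_neq0 (w_prim i)).
have w0 i : w i != 0.
  by rewrite (prim_root_eq0 (w_prim i)) -lt0n (prim_order_gt0 (w_prim i)).
pose z (m : 'X_{1..r}) i := w i ^+ m i / w i ^+ c i.
have z_sum m i : \sum_(k < n) z m i ^+ k =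
    if (m i %% d i == c i %% d i)%N then n%:R else 0.
  rewrite sum_root_of_unity; last first.
    by rewrite expr_div_n -!exprM ![(_ * n)%N]mulnC !exprM w_n !expr1n divr1.
  rewrite -(eq_prim_root_expr (w_prim i)) /z.
  have c0 : w i ^+ c i != 0 by rewrite expf_neq0.
  by rewrite -subr_eq0 -(divff c0) -mulrBl mulf_eq0 invr_eq0 (negPf c0) orbF
             subr_eq0.
have z_prod m : \prod_i \sum_(k < n) z m i ^+ k =
    if residues d m == residues d c then n%:R ^+ r else 0.
  under eq_bigr => i _ do rewrite z_sum.
  case: ifP => [/eqP/ffunP mc|/negP mc].
    rewrite (eq_bigr (fun=> n%:R)) ?prodr_const ?card_ord // => i _.
    by have := mc i; rewrite !ffunE => ->; rewrite eqxx.
  have [i mci] : exists i, (m i %% d i != c i %% d i)%N.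
    apply/existsP; apply: contra_notT mc; rewrite negb_exists => /forallP mc.
    apply/eqP/ffunP => i; rewrite !ffunE; apply/eqP.
    by rewrite -[_ == _]negbK mc.
  by rewrite (bigD1 i) //= (negPf mci) mul0r.
have : \sum_(k : {ffun 'I_r -> 'I_n})
    (\prod_i (w i ^+ c i) ^- k i) * f.@[fun i => w i ^+ k i] = 0.
  by apply: big1 => k _; rewrite f0 mulr0.
under eq_bigr => k _ do rewrite mevalE mulr_sumr.
rewrite exchange_big /= => sum0.
apply: (mulfI (expf_neq0 r n0)); rewrite mulr0 -{}[RHS]sum0.
rewrite mulr_sumr big_mkcond; apply: eq_bigr => m _.
transitivity (f@_m * \prod_i \sum_(k < n) z m i ^+ k).
  by rewrite z_prod; case: ifP; rewrite ?mulr0 // mulrC.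
rewrite bigA_distr_bigA mulr_sumr; apply: eq_bigr => k _.
rewrite mulrCA -big_split; congr (_ * _); apply: eq_bigr => i _ /=.
by rewrite /z expr_div_n mulrC -!exprM [(k i * _)%N]mulnC.
Qed.

End Grid.

(** * The vanishing ideal of a degenerate torus *)

Section Torus.
Variables (K : fieldType) (n r : nat) (phi : 'M[int]_(r, n)).
Implicit Types (t g P : {ffun 'I_r -> K}).

Lemma tpow_exponent_col t m : tpow t (exponent_col m) = \prod_i t i ^+ m i.
Proof. by apply: eq_bigr => i _; rewrite mxE. Qed.

Lemma tpowB t u u' : torus K r t -> tpow t (u - u') = tpow t u / tpow t u'.
Proof.
move=> t0; rewrite /tpow -prodf_div; apply: eq_bigr => i _.
by rewrite !mxE expfzDr ?t0 // -invr_expz.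
Qed.

Lemma tpow_mull g t u :
  tpow [ffun i => g i * t i] u = tpow g u * tpow t u.
Proof.
by rewrite /tpow -big_split; apply: eq_bigr => i _; rewrite ffunE expfzMl.
Qed.

(** t^(phi u) is the character u of T_X evaluated at pi(t), and pi is trivial
    on G. *)
Lemma tpow_torus_ker g u : torus_ker K phi g -> tpow g (phi *m u) = 1.
Proof.
move=> [g0 /ffunP gphi].
transitivity (\prod_(i < r) \prod_(j < n) g i ^ (phi i j * u j 0)).
  apply: eq_bigr => i _; rewrite mxE; apply: (big_morph (fun z => g i ^ z)).
    by move=> z z'; rewrite expfzDr ?g0.
  exact: expr0z.
rewrite exchange_big big1 // => j _.
transitivity (tpow g (col j phi) ^ u j 0); last first.
  by have := gphi j; rewrite !ffunE => ->; rewrite exp1rz.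
rewrite (big_morph (fun z => z ^ u j 0) (fun x y => expfzMl x y _)
  (exp1rz _ _)).
by apply: eq_bigr => i _; rewrite mxE exprz_exp.
Qed.

Lemma tpoint_refl P : tpoint phi P P.
Proof.
exists [ffun=> 1]; last by apply/ffunP => i; rewrite !ffunE mul1r.
split; first by move=> i; rewrite ffunE oner_neq0.
by apply/ffunP => j; rewrite !ffunE /tpow big1 // => i _; rewrite ffunE exp1rz.
Qed.

Variables (A : zmodType) (beta : {additive 'cV[int]_r -> A}).
Hypothesis phi_beta : short_exact phi beta.

Variables (eta : K) (a : 'I_r -> int) (d : 'I_r -> nat).
Hypotheses (eta_neq0 : eta != 0)
  (d_order : forall i, (d i).-primitive_root (eta ^ a i)).
Let Y := degenerate_torus phi a [set eta ^+ k | k in [set: nat]].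
Let L := degenerate_lattice beta (diag_int d).

(** Writing P = g . t^a, the factor g contributes 1 because m is in ker beta =
    im phi, and t^a contributes 1 because its i-th coordinate has order dividing
    d_i, which divides m_i. *)
Lemma tpow_degenerate P m : torus K r P -> Y (tpoint phi P) -> L m ->
  tpow P m = 1.
Proof.
move=> P0 [t tH tP] [z zL <-].
have [g gG <-] : tpoint phi [ffun i => t i ^ a i] P.
  by rewrite tP; exact: tpoint_refl.
have [u uE] := (let: And3 _ ker _ := phi_beta in ker _).1 zL.
rewrite tpow_mull {1}uE.
rewrite tpow_torus_ker // mul1r; apply: big1 => i _.
rewrite ffunE /diag_int mul_diag_mx !mxE -exprz_exp; have [k _ <-] := tH i.
rewrite exprnP (exprzAC eta) -!exprnP exprAC (prim_expr_order (d_order i)).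
by rewrite expr1n exp1rz.
Qed.

Lemma lattice_sub_vanishing :
  lattice_ideal K L `<=` vanishing_ideal phi beta Y.
Proof.
apply: ideal_gen_sub => _ [m Lm <-]; apply: ideal_gen_mem; split.
  exists (beta (exponent_col (pos_part m))) => m'.
  rewrite mcoeff_msupp mcoeffB !mcoeffX mdegA_exponent_col.
  have [<- _ //|_] := eqVneq (pos_part m) m'.
  have [<- _|_] := eqVneq (neg_part m) m'; last by rewrite subrr eqxx.
  apply/eqP; rewrite eq_sym -subr_eq0 -raddfB exponent_col_parts.
  by case: Lm => z + <- => /= ->.
move=> P P0 YP; rewrite mevalB !mevalX -!tpow_exponent_col.
apply/eqP; rewrite subr_eq0; apply/eqP/divr1_eq.
by rewrite -tpowB // exponent_col_parts tpow_degenerate.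
Qed.

Lemma vanishes_on_grid f (k : 'I_r -> nat) :
  vanishes_on phi Y f -> f.@[fun i => (eta ^ a i) ^+ k i] = 0.
Proof.
move=> f0.
pose P : {ffun 'I_r -> K} := [ffun i => [ffun i => eta ^+ k i] i ^ a i].
rewrite -[RHS](f0 P).
- by apply: meval_eq => i; rewrite !ffunE exprnP exprzAC.
- by move=> i; rewrite !ffunE expfz_neq0 // expf_neq0.
- by exists [ffun i => eta ^+ k i] => // i; rewrite ffunE; exists (k i).
Qed.

(** Here m - m' = D z with z the difference of the quotients by the d_i. *)
Lemma same_residues_lattice m m' : mdegA beta m = mdegA beta m' ->
  residues d m = residues d m' -> L (exponent_col m - exponent_col m').
Proof.
rewrite !mdegA_exponent_col => degE /ffunP resE.
have divE : diag_int d *m (\col_i ((m i %/ d i)%N%:Z - (m' i %/ d i)%N%:Z))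
    = exponent_col m - exponent_col m'.
  apply/colP => i; rewrite /diag_int mul_diag_mx !mxE.
  have := resE i; rewrite !ffunE => e.
  rewrite [in RHS](divn_eq (m i) (d i)) [in RHS](divn_eq (m' i) (d i)) e.
  lia.
by eexists; [|exact: divE]; rewrite /= divE raddfB degE subrr.
Qed.

Lemma vanishing_sub_lattice :
  vanishing_ideal phi beta Y `<=` lattice_ideal K L.
Proof.
apply: ideal_gen_sub => f [[alpha degf] f0].
have fibre0 m : m \in msupp f ->
    \sum_(x <- msupp f | residues d x == residues d m) f@_x = 0.
  move=> _; apply: residue_class_sum0 d_order _ m => k.
  exact: vanishes_on_grid.
rewrite [f]mpolyE (sum_fibre_differences fibre0 0%MM).
apply: ideal_gen_sum => m mf; rewrite -mul_mpolyC; apply: ideal_genM.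
have [m'f m'E] := fibre_repP (residues d) 0%MM mf.
by apply/lattice_ideal_binomial/same_residues_lattice; rewrite ?degf.
Qed.

End Torus.

Theorem theorem4p5
  (R : realType) (K : fieldType) (n r : nat)
  (Sigma : set (set 'rV[R]_n)) (v : 'I_r -> 'rV[int]_n)
  (fan_Sigma : is_fan Sigma)
  (complete_Sigma : complete_fan Sigma)
  (simplicial_Sigma : simplicial_fan Sigma)
  (rays_Sigma : primitive_ray_generators Sigma v)
  (A : zmodType) (beta : {additive 'cV[int]_r -> A})
  (exact_Cl : short_exact (ray_matrix v) beta)
  (pi_surj : set_surj (torus K r) (torus K n) (torus_map (ray_matrix v)))
  (N : nat) (torsion_order : (torsion_part A #= `I_N)%card)
  (torsion_coprime : forall p, p \in [pchar K] -> coprime N p)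
  (eta : K) (eta_neq0 : eta != 0)
  (H : set K) (H_def : H = [set eta ^+ k | k in [set: nat]])
  (H_finite : finite_set H)
  (a : 'I_r -> int) (d : 'I_r -> nat)
  (d_order : forall i, (d i).-primitive_root (eta ^ a i)) :
  vanishing_ideal (ray_matrix v) beta (degenerate_torus (ray_matrix v) a H)
  = lattice_ideal K (degenerate_lattice beta (diag_int d)).
Proof.
by rewrite H_def eqEsubset; split;
  [apply: vanishing_sub_lattice | apply: lattice_sub_vanishing].
Qed.
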